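(* Let $\alpha_0+\alpha_1+2\alpha_2+2\alpha_3=1$ and consider the system $$\frac{dx}{dt}=\frac{-2x^3y+2x^2y-(\alpha_1+2\alpha_2)x^2-(t-1+2\alpha_3)x+t}{t},$$ $$\frac{dy}{dt}=\frac{3x^2y^2-2xy^2+2(\alpha_1+2\alpha_2)xy+(t-1+2\alpha_3)y+(\alpha_1+\alpha_2)\alpha_2}{t}.$$ Make the change of parameters and variables $$x=\frac{\varepsilon TX}{1+\varepsilon TX},\quad y=\frac{(1+\varepsilon TX)(\varepsilon TXY+Y+A_1\varepsilon T)}{\varepsilon T},\quad t=\varepsilon T,$$ $$\alpha_0=-\frac{1-2A_2\varepsilon}{\varepsilon},\quad\alpha_1=\frac1\varepsilon,\quad\alpha_2=A_1,\quad\alpha_3=A_0$$ from $x,y,t,\alpha_0,\dots,\alpha_3$ to $X,Y,T,A_0,A_1,A_2,\varepsilon$. Then the system can be written in the new variables $T,X,Y$ and parameters $A_0,A_1,A_2,\varepsilon$ as a Hamiltonian system, and as $\varepsilon\to0$ this new system tends to the system $$\frac{dX}{dT}=\frac{2X^2Y}{T}-X^2-\frac{2A_0X}{T}+\frac1T,\qquad \frac{dY}{dT}=-\frac{2XY^2}{T}+2XY+\frac{2A_0Y}{T}+A_1,$$ with $A_0+A_1+A_2=\frac12$.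
   Context: A Hamiltonian system in $(X,Y)$ with independent variable $T$ is one of the form $dX/dT=\partial K/\partial Y$, $dY/dT=-\partial K/\partial X$ for a function $K(X,Y,T)$. ''Tends to'' means that the right-hand sides of the equations, as rational functions of $X,Y,T$ (with $A_i$ fixed), converge as $\varepsilon\to0$ to the right-hand sides of the limit system. *)

(* Defs.v *)
From HB Require Import structures.
From mathcomp Require Import all_boot all_order all_algebra.
From mathcomp Require Import all_classical all_reals all_analysis.
From mathcomp Require Import -(notations) mpoly.
Import Order.TTheory GRing.Theory Num.Theory.
Import numFieldNormedType.Exports.

Set Implicit Arguments.
Unset Strict Implicit.
Unset Printing Implicit Defensive.

Local Open Scope classical_set_scope.
Local Open Scope ring_scope.

(* K is any numFieldType, so that the real numbers (R : realType) and the complex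
   numbers R[i] are both instances; is_derive is the derivative over K, that is,
   the holomorphic one when K is R[i]. *)
Section PlanarSystems.
Variable K : numFieldType.
Implicit Types (U : set K) (f g h : K -> K -> K -> K) (x y : K -> K).

(* Functions of (position, momentum, time), in this order. *)
Definition solution_on U f g x y : Prop :=
  forall t : K, U t -> is_derive t (1 : K) x (f (x t) (y t) t) /\
                   is_derive t (1 : K) y (g (x t) (y t) t).

(* The systems considered here all have t in the denominator, whence T != 0. *)
Definition hamiltonian_system h f g : Prop :=
  forall X Y T : K, T != 0 ->
    is_derive Y (1 : K) (fun Y' : K => h X Y' T) (f X Y T) /\
    is_derive X (1 : K) (fun X' : K => h X' Y T) (- g X Y T).

Definition peval (p : mpoly 3 K) (X Y T : K) : K :=
  meval (tnth [tuple X; Y; T]) p.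

Definition ratfun_repr f (p q : mpoly 3 K) : Prop :=
  forall X Y T : K, T != 0 -> peval q X Y T != 0 /\
    f X Y T = peval p X Y T / peval q X Y T.

(* Convergence of rational functions in X, Y, T: numerators and denominators of
   bounded degree, all of whose coefficients converge, the limit denominator
   being nonzero (on T != 0 by ratfun_repr).  In particular f eps X Y T tends to
   f0 X Y T at every point with T != 0. *)
Definition ratfun_tends_to (f : K -> K -> K -> K -> K) f0 : Prop :=
  exists (d : nat) (p q : K -> mpoly 3 K) (p0 q0 : mpoly 3 K),
    [/\ forall eps, eps != 0 ->
          [/\ (msize (p eps) <= d)%N, (msize (q eps) <= d)%N
            & ratfun_repr (f eps) (p eps) (q eps)],
        ratfun_repr f0 p0 q0,
        forall m : multinom 3,
          mcoeff m (p eps) @[eps --> 0^'] --> mcoeff m p0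
      & forall m : multinom 3,
          mcoeff m (q eps) @[eps --> 0^'] --> mcoeff m q0].

End PlanarSystems.

Section Systems.
Variable K : numFieldType.

Definition original_dx (a1 a2 a3 x y t : K) : K :=
  (- 2 * x ^+ 3 * y + 2 * x ^+ 2 * y - (a1 + 2 * a2) * x ^+ 2
   - (t - 1 + 2 * a3) * x + t) / t.

Definition original_dy (a1 a2 a3 x y t : K) : K :=
  (3 * x ^+ 2 * y ^+ 2 - 2 * x * y ^+ 2 + 2 * (a1 + 2 * a2) * x * y
   + (t - 1 + 2 * a3) * y + (a1 + a2) * a2) / t.

Definition limit_dX (A0 X Y T : K) : K :=
  2 * X ^+ 2 * Y / T - X ^+ 2 - 2 * A0 * X / T + 1 / T.

Definition limit_dY (A0 A1 X Y T : K) : K :=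
  - (2 * X * Y ^+ 2) / T + 2 * X * Y + 2 * A0 * Y / T + A1.

Definition change_of_parameters (eps A0 A1 A2 a0 a1 a2 a3 : K) : Prop :=
  [/\ a0 = - ((1 - 2 * A2 * eps) / eps), a1 = 1 / eps, a2 = A1 & a3 = A0].

Definition change_of_variables (eps A1 x y t X Y T : K) : Prop :=
  [/\ t = eps * T,
      x = eps * T * X / (1 + eps * T * X)
    & y = (1 + eps * T * X) * (eps * T * X * Y + Y + A1 * eps * T) / (eps * T)].

(* The system (f, g) in (x, y, t) is the system (F, G) written in the variables
   (X, Y, T), wherever the change of variables is defined. *)
Definition rewritten_as (eps A1 : K) (f g F G : K -> K -> K -> K) : Prop :=
  forall (U : set K) (x y X Y : K -> K),
    open U ->
    (forall T, U T -> T != 0 /\ 1 + eps * T * X T != 0) ->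
    (forall T, U T -> change_of_variables eps A1
       (x (eps * T)) (y (eps * T)) (eps * T) (X T) (Y T) T) ->
    solution_on [set eps * T | T in U] f g x y <-> solution_on U F G X Y.

End Systems.

(* Main.v *)
Require Import Defs.
From mathcomp Require Import all_boot all_order all_algebra.
From mathcomp Require Import all_classical all_reals all_analysis.
From mathcomp Require Import -(notations) mpoly.
From mathcomp Require Import ring.
Import Order.TTheory GRing.Theory Num.Theory.
Import numFieldNormedType.Exports.

(* With w = eps T X one has w = x / (1 - x) and 1 + w = 1 / (1 - x), so the change
   of variables inverts rationally to X = x / (eps T (1 - x)) and
   Y = eps T (1 - x) (y (1 - x) - A1); both directions of the rewriting are then
   the chain rule.  In the new variables the 1 / eps terms cancel: T dX/dT and
   T dY/dT are polynomials of degree at most 1 in eps, with the limit system as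
   their constant term in eps. *)

Local Open Scope ring_scope.

(* realfun's is_derive1_comp and is_deriveV do not cover K = R[i]. *)
Lemma is_derive1_comp_num (K : numFieldType) (f g : K -> K) (x a b : K) :
  is_derive (g x) 1 f a -> is_derive x 1 g b ->
  is_derive x 1 (fun z => f (g z)) (a * b).
Proof.
move=> [df <-] [dg <-].
have df' : differentiable f (g x) by apply/derivable1_diffP.
have dg' : differentiable g x by apply/derivable1_diffP.
apply: (@DeriveDef _ _ _ _ _ (f \o g)).
  exact/derivable1_diffP/differentiable_comp.
rewrite deriveE; last exact: differentiable_comp.
by rewrite (diff_comp dg' df') /= (deriv1E df) (deriv1E dg) !derive1E scale1r mulrC.
Qed.

Lemma is_deriveV_num (K : numFieldType) (f : K -> K) (x v df : K) :
  f x != 0 -> is_derive x v f df ->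
  is_derive x v (fun z => (f z)^-1) (- (f x) ^- 2 * df).
Proof.
move=> fx0 [df_ <-]; apply: DeriveDef; first exact: derivableV.
by rewrite deriveV.
Qed.

Lemma is_derive1_scale (K : numFieldType) (f : K -> K) (c x a : K) :
  is_derive (c * x) 1 f a -> is_derive x 1 (fun z => f (c * z)) (c * a).
Proof.
move=> df; rewrite mulrC; apply: is_derive1_comp_num => //.
by apply: is_derive_eq; rewrite /GRing.scale /=; ring.
Qed.

(** Undo the rescaling by applying [is_derive1_scale] with factor [c^-1] to [f (c * z)]. It turns a
    derivative in T into one in t = eps T. *)
Lemma is_derive1_unscale (K : numFieldType) (f : K -> K) (c x a : K) :
  c != 0 ->
  is_derive x 1 (fun z => f (c * z)) (c * a) -> is_derive (c * x) 1 f a.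
Proof.
move=> c0 df; have -> : f = fun z => f (c * (c^-1 * z)).
  by apply/funext => z; rewrite mulVKf.
rewrite -[a](mulKf c0); apply: (@is_derive1_scale _ (fun z => f (c * z))).
by rewrite mulKf.
Qed.

Section NewSystem.
Variable K : numFieldType.

Definition new_dX (A0 eps X Y T : K) : K :=
  (2 * X ^+ 2 * Y - T * X ^+ 2 - 2 * A0 * X + 1
   + eps * T * (2 * X ^+ 3 * Y + (1 - 2 * A0) * X ^+ 2 + X)) / T.

Definition new_dY (A0 A1 eps X Y T : K) : K :=
  (- (2 * X * Y ^+ 2) + 2 * T * X * Y + 2 * A0 * Y + A1 * T
   + eps * T * (- (3 * X ^+ 2 * Y ^+ 2) - 2 * (1 - 2 * A0) * X * Y - Y
                + A1 * (A1 + 2 * A0 - 1))) / T.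

(** The part under [T^-1] is an antiderivative of [new_dX] in Y; the last term, free of Y, is then
    forced by [new_dY]. *)
Definition new_ham (A0 A1 eps X Y T : K) : K :=
  T^-1 * (X ^+ 2 * Y ^+ 2 - T * X ^+ 2 * Y - 2 * A0 * X * Y + Y
   + eps * T * (X ^+ 3 * Y ^+ 2 + (1 - 2 * A0) * X ^+ 2 * Y + X * Y))
  - A1 * (1 + eps * (A1 + 2 * A0 - 1)) * X.

Lemma new_system_hamiltonian (A0 A1 eps : K) :
  hamiltonian_system (new_ham A0 A1 eps) (new_dX A0 eps) (new_dY A0 A1 eps).
Proof.
move=> X Y T T0; split; rewrite /new_ham /new_dX /new_dY;
  by apply: is_derive_eq; rewrite /GRing.scale /= ?fctE /=; field.
Qed.

Section Rewriting.
Variables (eps A0 A1 : K) (x y X Y : K -> K) (T : K).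
Hypothesis eps0 : eps != 0.
(** Derivatives at T are to be compared, so the relations must hold on a whole neighbourhood; the
    values at T itself are extracted just below. *)
Hypothesis nearxy : \forall S \near T,
  [/\ S != 0, 1 + eps * S * X S != 0 & change_of_variables eps A1
     (x (eps * S)) (y (eps * S)) (eps * S) (X S) (Y S) S].

Let T0 : T != 0. Proof. by have [] := nbhs_singleton nearxy. Qed.

Let w0 : 1 + eps * T * X T != 0.
Proof. by have [] := nbhs_singleton nearxy. Qed.

Let xE : x (eps * T) = eps * T * X T / (1 + eps * T * X T).
Proof. by have [_ _ []] := nbhs_singleton nearxy. Qed.

Let yE : y (eps * T) = (1 + eps * T * X T) *
  (eps * T * X T * Y T + Y T + A1 * eps * T) / (eps * T).
Proof. by have [_ _ []] := nbhs_singleton nearxy. Qed.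

Lemma original_of_new :
  is_derive T 1 X (new_dX A0 eps (X T) (Y T) T) ->
  is_derive T 1 Y (new_dY A0 A1 eps (X T) (Y T) T) ->
  is_derive (eps * T) 1 x (original_dx (1 / eps) A1 A0
    (x (eps * T)) (y (eps * T)) (eps * T)) /\
  is_derive (eps * T) 1 y (original_dy (1 / eps) A1 A0
    (x (eps * T)) (y (eps * T)) (eps * T)).
Proof.
move=> dX dY.
have dw : is_derive T 1 (fun S => 1 + eps * S * X S)
    (eps * (X T + T * new_dX A0 eps (X T) (Y T) T)).
  by apply: is_derive_eq; rewrite /GRing.scale /= ?fctE /=; ring.
(* With the derivatives of 1/(1 + w) and 1/T in the context, instance search can differentiate the
   quotients below. *)
have dwV := is_deriveV_num _ (fun S => 1 + eps * S * X S) _ _ _ w0 dw.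
have dTV := is_deriveV_num _ id _ _ _ T0 (is_derive_id T 1).
split; apply: is_derive1_unscale => //.
- apply: (@near_eq_is_derive _ _ _
    (fun S => eps * S * X S * (1 + eps * S * X S)^-1)).
    by apply: filterS nearxy => S [_ _ [_ -> _]].
  apply: is_derive_eq; rewrite /GRing.scale /= ?fctE /= /original_dx xE yE.
  by rewrite /new_dX; field; rewrite ?eps0 ?T0 ?w0.
(* Here y is regrouped so that [eps^-1] is a constant factor and S is the only function inverted, as
   [dTV] requires. *)
- apply: (@near_eq_is_derive _ _ _ (fun S => eps^-1 * ((1 + eps * S * X S) *
    ((1 + eps * S * X S) * Y S + A1 * eps * S) * S^-1))).
    by apply: filterS nearxy => S [_ _ [_ _ ->]]; rewrite invfM; ring.
  apply: is_derive_eq; rewrite /GRing.scale /= ?fctE /= /original_dy xE yE.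
  by rewrite /new_dX /new_dY; field; rewrite ?eps0 ?T0 ?w0.
Qed.

Lemma new_of_original :
  is_derive (eps * T) 1 x (original_dx (1 / eps) A1 A0
    (x (eps * T)) (y (eps * T)) (eps * T)) ->
  is_derive (eps * T) 1 y (original_dy (1 / eps) A1 A0
    (x (eps * T)) (y (eps * T)) (eps * T)) ->
  is_derive T 1 X (new_dX A0 eps (X T) (Y T) T) /\
  is_derive T 1 Y (new_dY A0 A1 eps (X T) (Y T) T).
Proof.
move=> /is_derive1_scale dx /is_derive1_scale dy.
have wV S : 1 + eps * S * X S != 0 ->
    1 - eps * S * X S / (1 + eps * S * X S) = (1 + eps * S * X S)^-1.
  by move=> wS0; field.
(* This quantity equals eps T / (1 + w); it is the denominator in the inverse formula for X and the
   leading factor in that for Y. *)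
have x1 : eps * T * (1 - x (eps * T)) != 0.
  by rewrite xE wV// !mulf_neq0 ?invr_eq0.
have dV : is_derive T 1 (fun S => eps * S * (1 - x (eps * S)))
    (eps * (1 - x (eps * T) - T * (eps * original_dx (1 / eps) A1 A0
       (x (eps * T)) (y (eps * T)) (eps * T)))).
  by apply: is_derive_eq; rewrite /GRing.scale /= ?fctE /=; ring.
have {}dV := is_deriveV_num _ (fun S => eps * S * (1 - x (eps * S))) _ _ _ x1 dV.
split.
- apply: (@near_eq_is_derive _ _ _
    (fun S => x (eps * S) * (eps * S * (1 - x (eps * S)))^-1)).
    apply: filterS nearxy => S [S0 wS0 [_ -> _]]; rewrite wV //.
    by field; rewrite eps0 S0 wS0.
  apply: is_derive_eq; rewrite /GRing.scale /= ?fctE /=.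
  by rewrite /original_dx xE yE wV // /new_dX; field; rewrite ?eps0 ?T0 ?w0.
- apply: (@near_eq_is_derive _ _ _ (fun S => eps * S * (1 - x (eps * S)) *
    (y (eps * S) * (1 - x (eps * S)) - A1))).
    apply: filterS nearxy => S [S0 wS0 [_ -> ->]]; rewrite wV //.
    by field; rewrite eps0 S0 wS0.
  apply: is_derive_eq; rewrite /GRing.scale /= ?fctE /=.
  rewrite /original_dx /original_dy xE yE wV //.
  by rewrite /new_dY; field; rewrite ?eps0 ?T0 ?w0.
Qed.

End Rewriting.

Lemma new_system_rewritten (A0 A1 eps : K) : eps != 0 ->
  rewritten_as eps A1 (original_dx (1 / eps) A1 A0) (original_dy (1 / eps) A1 A0)
    (new_dX A0 eps) (new_dY A0 A1 eps).
Proof.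
move=> eps0 U x y X Y oU U0 cov.
(* Openness of U spreads the pointwise relations to a neighbourhood of each T, which reduces the
   equivalence to one point at a time. *)
have nearxy T : U T -> \forall S \near T, [/\ S != 0, 1 + eps * S * X S != 0
    & change_of_variables eps A1
        (x (eps * S)) (y (eps * S)) (eps * S) (X S) (Y S) S].
  move=> UT; apply: filterS (open_nbhs_nbhs (conj oU UT)) => S US.
  by have [S0 w0] := U0 _ US; split=> //; exact: cov.
split=> [sol T UT | sol _ [T UT <-]].
- have [] := sol (eps * T); first by exists T.
  exact: new_of_original (nearxy _ UT).
- have [] := sol _ UT.
  exact: original_of_new (nearxy _ UT).
Qed.

(** Each numerator coefficient is affine in eps, hence continuous at 0, and the sizes of [p0], [p1]
    and [q] bound all degrees uniformly. *)
Lemma ratfun_tends_to_affine (f : K -> K -> K -> K -> K) f0 (p0 p1 q : mpoly 3 K) :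
  (forall eps, ratfun_repr (f eps) (p0 + eps *: p1) q) ->
  ratfun_repr f0 p0 q -> ratfun_tends_to f f0.
Proof.
move=> fE f0E.
exists (maxn (maxn (msize p0) (msize p1)) (msize q)).
exists (fun eps => p0 + eps *: p1), (fun=> q), p0, q; split=> //.
- move=> eps _; split=> //; last by rewrite leq_maxr.
  rewrite leq_max; apply/orP; left; apply: leq_trans (msizeD_le _ _) _.
  by rewrite geq_max leq_maxl /= leq_max msizeZ_le orbT.
- move=> m; under eq_fun do rewrite mcoeffD mcoeffZ.
  (* The punctured limit follows from the full one; the limit is then written with [0 * mcoeff m p1]
     to match the sum and product rules. *)
  apply: cvg_within_filter.
  have F0 : Filter (nbhs (0 : K)) by exact: nbhs_filter.
  suff : (mcoeff m p0 + e * mcoeff m p1 @[e --> (0 : K)] -->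
      mcoeff m p0 + 0 * mcoeff m p1)%classic by rewrite mul0r addr0.
  exact: (cvgD (cvg_cst _) (cvgM cvg_id (cvg_cst _))).
- by move=> m; exact: cvg_cst.
Qed.

Let Xp : mpoly 3 K := mpolyX K (mnm1 0).
Let Yp : mpoly 3 K := mpolyX K (mnm1 1).
Let Tp : mpoly 3 K := mpolyX K (mnm1 2).

Let evalX (X Y T : K) : meval (tnth [tuple X; Y; T]) Xp = X.
Proof. by rewrite mevalXU. Qed.

Let evalY (X Y T : K) : meval (tnth [tuple X; Y; T]) Yp = Y.
Proof. by rewrite mevalXU. Qed.

Let evalT (X Y T : K) : meval (tnth [tuple X; Y; T]) Tp = T.
Proof. by rewrite mevalXU. Qed.

Let evalE := (mevalD, mevalN, mevalM, mevalZ, meval1, evalX, evalY, evalT).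

Lemma new_dX_tends_to (A0 : K) : ratfun_tends_to (new_dX A0) (limit_dX A0).
Proof.
apply: (@ratfun_tends_to_affine _ _
  (* The witnesses are the eps-free and eps-linear parts of T dX/dT, over the common denominator
     T. *)
  (2 *: (Xp * Xp * Yp) - Tp * Xp * Xp - (2 * A0) *: Xp + 1)
  (Tp * (2 *: (Xp * Xp * Xp * Yp) + (1 - 2 * A0) *: (Xp * Xp) + Xp)) Tp).
- move=> eps X Y T T0; rewrite /peval !evalE; split=> //.
  by rewrite /new_dX; field.
- move=> X Y T T0; rewrite /peval !evalE; split=> //.
  by rewrite /limit_dX; field.
Qed.

Lemma new_dY_tends_to (A0 A1 : K) :
  ratfun_tends_to (new_dY A0 A1) (limit_dY A0 A1).
Proof.
apply: (@ratfun_tends_to_affine _ _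
  (- (2 *: (Xp * Yp * Yp)) + 2 *: (Tp * Xp * Yp) + (2 * A0) *: Yp + A1 *: Tp)
  (Tp * (- (3 *: (Xp * Xp * Yp * Yp)) - (2 * (1 - 2 * A0)) *: (Xp * Yp) - Yp
         + (A1 * (A1 + 2 * A0 - 1)) *: 1)) Tp).
- move=> eps X Y T T0; rewrite /peval !evalE; split=> //.
  by rewrite /new_dY; field.
- move=> X Y T T0; rewrite /peval !evalE; split=> //.
  by rewrite /limit_dY; field.
Qed.

End NewSystem.

Theorem theorem3p3 (K : numFieldType) (A0 A1 A2 : K) :
  exists H F G : K -> K -> K -> K -> K,
    [/\ forall eps a0 a1 a2 a3 : K,
          eps != 0 ->
          a0 + a1 + 2 * a2 + 2 * a3 = 1 ->
          change_of_parameters eps A0 A1 A2 a0 a1 a2 a3 ->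
          [/\ A0 + A1 + A2 = 1 / 2,
              rewritten_as eps A1 (original_dx a1 a2 a3) (original_dy a1 a2 a3)
                (F eps) (G eps)
            & hamiltonian_system (H eps) (F eps) (G eps)],
        ratfun_tends_to F (limit_dX A0)
      & ratfun_tends_to G (limit_dY A0 A1)].
Proof.
exists (new_ham K A0 A1), (new_dX K A0), (new_dY K A0 A1); split.
- move=> eps a0 a1 a2 a3 eps0 sumA [a0E a1E a2E a3E].
  move: sumA; rewrite {}a0E {}a1E {}a2E {}a3E.
  (* The poles 1/eps of [a0] and [a1] cancel and leave 2 A2, so the normalisation of the old
     parameters becomes that of the new ones. *)
  have -> : - ((1 - 2 * A2 * eps) / eps) + 1 / eps + 2 * A1 + 2 * A0 =
      2 * (A0 + A1 + A2) by field.
  move=> sumA; split.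
  + by apply/(canRL (mulfK _)); rewrite ?pnatr_eq0 // mulrC.
  + exact: new_system_rewritten.
  + exact: new_system_hamiltonian.
- exact: new_dX_tends_to.
- exact: new_dY_tends_to.
Qed.
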